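(* Let $F$ be a field with fixed algebraic closure $\overline{F}$, and let $\mathscr{M}_{2,\overline{F}}$ be the set of roots of unity $\zeta\in\overline{F}$ such that $[F(\zeta):F]=2$. Then $$\mathscr{M}_{2,\overline{F}}=\operatorname{Eq}(\kappa_F,0_{\mu_\infty})\setminus \mu_{\infty_F},$$ where $\operatorname{Eq}(\kappa_F,0_{\mu_\infty})=\{\zeta\in\mu_\infty : \kappa_F(\zeta)=[0]_F\}$, with $\mu_\infty$, $\mu_{\infty_F}$, $0_{\mu_\infty}$ and $\kappa_F$ as defined in the context.
   Context: $\mathbb{N}=\{1,2,\dots\}$; $\mathbb{P}$ is the set of prime numbers. $\zeta_n$ denotes a primitive $n$-th root of unity in $\overline{F}$; whenever $\zeta_n$ is written, it is implicitly assumed that the characteristic of $F$ does not divide $n$. For $\alpha\in\overline{F}$ a root of unity, $\operatorname{o}_F(\alpha)$ (order of $\alpha$ over $F$) is the least integer $k\ge 1$ with $\alpha^k\in F$; it is the same for all primitive $n$-th roots of unity. $\epsilon_n(p)$ is the exponent of the prime $p$ in $n$ (so $\epsilon_n(p)=0$ if $p\nmid n$). $\mu_\infty$ is the set of all roots of unity in $\overline{F}$, and $\mu_{\infty_F}=\mu_\infty\cap F$. $F(\mu_\infty)/F$ is the quotient of additive groups, and $[a]_F$ is the coset of $a$. The map $0_{\mu_\infty}:\mu_\infty\to F(\mu_\infty)/F$ sends every element to $[0]_F$. The function $\operatorname{t}_F$: for $p$ prime and $e\in\mathbb{N}$, $$\operatorname{t}_F(p^e)=\begin{cases}p^e & p \text{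 odd and } \operatorname{o}_F(\zeta_{p^e})\ne 1,\\ 2^e & p=2 \text{ and } \operatorname{o}_F(\zeta_{2^e})>2,\\ 2 & p=2\text{ and }\operatorname{o}_F(\zeta_{2^e})=2,\\ 1 & \operatorname{o}_F(\zeta_{p^e})=1,\end{cases}$$ and $\operatorname{t}_F(n)=\prod_{p\in\mathbb{P},\,p\mid n}\operatorname{t}_F(p^{\epsilon_n(p)})$ (so $\operatorname{t}_F(1)=1$). $c_2$ denotes the unique integer $e\in\mathbb{N}$, if it exists, such that $\zeta_{2^e}\notin F$, $\operatorname{t}_F(2^e)\ne 2$ and $\zeta_{2^e}-\zeta_{2^e}^{-1}\in F$. If no such $e$ exists, the condition $\epsilon_n(2)\ne c_2$ is regarded as always true. The map $\kappa_F:\mu_\infty\to F(\mu_\infty)/F$ is defined on a primitive $n$-th root of unity $\zeta_n$ by $$\kappa_F(\zeta_n)=\begin{cases}[\zeta_{\operatorname{t}_F(n)}+\zeta_{\operatorname{t}_F(n)}^{-1}]_F & \text{if } \operatorname{o}_F(\zeta_{2^{\epsilon_n(2)}})\ne 2 \text{ and } \epsilon_n(2)\ne c_2,\\ [\zeta_{\operatorname{t}_F(n)}-\zeta_{\operatorname{t}_F(n)}^{-1}]_F & \text{if } \operatorname{o}_F(\zeta_{2^{\epsilon_n(2)}})\ne 2 \text{ and } \epsilon_n(2)= c_2,\\ [\zeta_{2^{\epsilon_n(2)}}(\zeta_{\operatorname{t}_F(n)}-\zeta_{\operatorname{t}_F(n)}^{-1})]_F & \text{otherwise.}\end{cases}$$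 On the right-hand side, $\zeta_k$ stands for an arbitrary primitive $k$-th root of unity, fixed once and for all for each $k$. *)

(* Defs.v *)
From HB Require Import structures.
From mathcomp Require Import all_boot all_order all_algebra.
From mathcomp Require Import boolp classical_sets.

Set Implicit Arguments.
Unset Strict Implicit.
Unset Printing Implicit Defensive.

Import GRing.Theory.

Local Open Scope classical_set_scope.
Local Open Scope ring_scope.
Local Open Scope quotient_scope.

(* A field F with a fixed algebraic closure is given by an embedding
   [iota : F -> L] into an algebraically closed field L, algebraic over F. *)
Definition is_algebraic_closure (F : fieldType) (L : closedFieldType)
  (iota : {rmorphism F -> L}) : Prop :=
  forall x : L, algebraicOver iota x.

Section Adjoin.

Variables (F L : fieldType) (iota : {rmorphism F -> L}).

(* [divringClosed L] is the type of subfields of L, so this is membership in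
   the smallest subfield F(A) of L that contains F and A. *)
Definition adjoin_pred (A : set L) : {pred L} := fun x =>
  `[< forall K : divringClosed L,
        (forall a : F, iota a \in K) -> (forall y, A y -> y \in K) -> x \in K >].

Lemma adjoin_divring (A : set L) : divring_closed (adjoin_pred A).
Proof.
split=> [|x y /asboolP Kx /asboolP Ky|x y /asboolP Kx /asboolP Ky];
  apply/asboolP => K KF KA; first exact: rpred1.
- by rewrite rpredB ?Kx ?Ky.
- by rewrite rpred_div ?Kx ?Ky.
Qed.

HB.instance Definition _ (A : set L) :=
  GRing.isDivringClosed.Build L (adjoin_pred A) (adjoin_divring A).

Section Structures.

Variable A : set L.

Record adjoin : Type :=
  Adjoin { adjoin_val : L; adjoin_valP : adjoin_val \in adjoin_pred A }.

HB.instance Definition _ := [isSub for adjoin_val].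
HB.instance Definition _ := [Choice of adjoin by <:].
HB.instance Definition _ := [SubChoice_isSubIntegralDomain of adjoin by <:].
HB.instance Definition _ := [SubIntegralDomain_isSubField of adjoin by <:].

Lemma base_in_adjoin (a : F) : iota a \in adjoin_pred A.
Proof. by apply/asboolP => K KF _; apply: KF. Qed.

Lemma gen_in_adjoin (x : L) : A x -> x \in adjoin_pred A.
Proof. by move=> Ax; apply/asboolP => K _; apply. Qed.

Definition adjoin_base (a : F) : adjoin := Adjoin (base_in_adjoin a).

Definition adjoin_gen (x : A) : adjoin := Adjoin (gen_in_adjoin (set_valP x)).

Lemma adjoin_base_zmod_morphism : zmod_morphism adjoin_base.
Proof. by move=> a b; apply: val_inj; rewrite /= rmorphB. Qed.

Lemma adjoin_base_monoid_morphism : monoid_morphism adjoin_base.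
Proof.
by split=> [|a b]; apply: val_inj; rewrite /= ?rmorph1 ?rmorphM.
Qed.

HB.instance Definition _ := GRing.isZmodMorphism.Build F adjoin adjoin_base
  adjoin_base_zmod_morphism.
HB.instance Definition _ := GRing.isMonoidMorphism.Build F adjoin adjoin_base
  adjoin_base_monoid_morphism.

Definition adjoin_scale (a : F) (x : adjoin) : adjoin := adjoin_base a * x.

Lemma adjoin_scaleA a b x :
  adjoin_scale a (adjoin_scale b x) = adjoin_scale (a * b) x.
Proof. by rewrite /adjoin_scale rmorphM mulrA. Qed.

Lemma adjoin_scale1 : left_id 1 adjoin_scale.
Proof. by move=> x; rewrite /adjoin_scale rmorph1 mul1r. Qed.

Lemma adjoin_scaleDr : right_distributive adjoin_scale +%R.
Proof. by move=> a x y; apply: mulrDr. Qed.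

Lemma adjoin_scaleDl x : {morph adjoin_scale^~ x : a b / a + b}.
Proof. by move=> a b; rewrite /adjoin_scale rmorphD mulrDl. Qed.

HB.instance Definition _ := GRing.Zmodule_isLmodule.Build F adjoin
  adjoin_scaleA adjoin_scale1 adjoin_scaleDr adjoin_scaleDl.

Definition base_pred : {pred adjoin} := fun x => `[< range adjoin_base x >].

Lemma base_zmod_closed : zmod_closed base_pred.
Proof.
split=> [|x y /asboolP[a _ <-] /asboolP[b _ <-]]; apply/asboolP.
- by exists 0 => //; rewrite rmorph0.
- by exists (a - b) => //; rewrite rmorphB.
Qed.

HB.instance Definition _ :=
  GRing.isZmodClosed.Build adjoin base_pred base_zmod_closed.

(* The quotient F(A)/F of additive groups, and the coset [x]_F. *)
Definition adjoin_mod_base : zmodType := Quotient.quot base_pred.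

Definition coset_base (x : adjoin) : adjoin_mod_base :=
  \pi_(Quotient.quot base_pred) x.

(* [F(A) : F] = d; an element of [Vector.axiom d V] is a linear bijection from
   V to F^d. *)
Definition adjoin_degree_is (d : nat) : Prop := inhabited (Vector.axiom d adjoin).

End Structures.

End Adjoin.

Definition mu_infty (L : fieldType) : set L :=
  [set x | exists2 n, (0 < n)%N & x ^+ n = 1].
Arguments mu_infty L : clear implicits.

Section Kappa.

Variables (F L : fieldType) (iota : {rmorphism F -> L}).

(* [zeta k] is the chosen primitive k-th root of unity, for k >= 1 not divisible
   by the characteristic; its value at other k is irrelevant. *)
Definition is_primitive_choice (zeta : nat -> mu_infty L) : Prop :=
  forall k, [pchar F]^'.-nat k -> k.-primitive_root (val (zeta k)).

Definition mu_infty_base : set (mu_infty L) :=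
  [set z | range iota (val z)].

Definition mu_degree2 : set (mu_infty L) :=
  [set z | adjoin_degree_is iota [set val z] 2%N].

(* The n such that z is a primitive n-th root of unity. *)
Definition mu_order (z : mu_infty L) : nat :=
  xget 0%N [set n | n.-primitive_root (val z)].

(* o_F(z), the least k >= 1 with z ^ k in F. *)
Definition order_over (z : mu_infty L) : nat :=
  xget 0%N [set k | [/\ (0 < k)%N, range iota (val z ^+ k) &
    forall j, (0 < j)%N -> range iota (val z ^+ j) -> (k <= j)%N]].

Variable zeta : nat -> mu_infty L.

Definition t_primepow (p e : nat) : nat :=
  let o := order_over (zeta (p ^ e)%N) in
  if o == 1%N then 1%N
  else if p == 2%N then (if o == 2%N then 2%N else (2 ^ e)%N)
  else (p ^ e)%N.

Definition t_fun (n : nat) : nat :=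
  (\prod_(p <- primes n) t_primepow p (logn p n))%N.

Definition c2_spec (e : nat) : Prop :=
  let z := val (zeta (2 ^ e)%N) in
  [/\ (0 < e)%N, [pchar F]^'.-nat (2 ^ e)%N, ~ range iota z,
      t_fun (2 ^ e)%N <> 2%N & range iota (z - z^-1)].

(* e = c_2; false for every e when c_2 does not exist. *)
Definition is_c2 (e : nat) : Prop := unique c2_spec e.

Definition zeta_gen (k : nat) : adjoin iota (mu_infty L) :=
  adjoin_gen iota (zeta k).

Definition kappa (z : mu_infty L) : adjoin_mod_base iota (mu_infty L) :=
  let n := mu_order z in
  let e := logn 2 n in
  let zt := zeta_gen (t_fun n) in
  let z2 := zeta_gen (2 ^ e)%N in
  if order_over (zeta (2 ^ e)%N) != 2%N then
    if ~~ `[< is_c2 e >] then coset_base (zt + zt^-1)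
    else coset_base (zt - zt^-1)
  else coset_base (z2 * (zt - zt^-1)).

Definition zero_map (z : mu_infty L) : adjoin_mod_base iota (mu_infty L) :=
  coset_base 0.

End Kappa.

Definition equalizer (X Y : Type) (f g : X -> Y) : set X :=
  [set x | f x = g x].

(* Main.v *)
(** If [F(z)/F] is quadratic with nontrivial automorphism [z |-> z ^+ s], then
    [n | (s - 1)(s + 1)] where n is the order of z.  So every root of unity
    u in [<z>] of odd prime power order is fixed or inverted, and if it has
    2-power order it goes to u, -u, 1/u or -1/u.  A 2-part w of z outside F
    moves by [w |-> -w] iff [order_over w = 2], and otherwise by
    [w |-> -1/w] iff its exponent is [c_2]; in each case the representative of
    [kappa z] is fixed.
    Conversely, if that representative lies in F, then [zeta_t], [zeta_t ^+ 2]
    or w satisfies a quadratic equation over F, and the field it generates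
    contains every prime-power part of z. *)

Require Import Defs.
From HB Require Import structures.
From mathcomp Require Import all_boot all_order all_algebra.
From mathcomp Require Import boolp classical_sets.
From mathcomp Require Import ring zify.

Set Implicit Arguments.
Unset Strict Implicit.
Unset Printing Implicit Defensive.

Import GRing.Theory.

Local Open Scope ring_scope.

(** * Subfields generated by an element of degree at most two *)

Section Quadratic.

Variables (L : fieldType) (K : divringClosed L).

(** Degree at most two: elements of [K] qualify, and degree exactly two is expressed by adding
    [z \notin K]. *)
Definition quadratic (z : L) : Prop :=
  exists a b, [/\ a \in K, b \in K & z ^+ 2 = a * z + b].

Definition affine_span (g : L) : {pred L} := fun x =>
  `[< exists c d, [/\ c \in K, d \in K & x = c + d * g] >].

Lemma affine_spanP g x :
  reflect (exists c d, [/\ c \in K, d \in K & x = c + d * g])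
          (x \in affine_span g).
Proof. exact: asboolP. Qed.

Lemma affine_span_base g x : x \in K -> x \in affine_span g.
Proof. by move=> Kx; apply/affine_spanP; exists x, 0;
  rewrite Kx rpred0 mul0r addr0. Qed.

Lemma affine_span_gen g : g \in affine_span g.
Proof. by apply/affine_spanP; exists 0, 1;
  rewrite rpred0 rpred1 mul1r add0r. Qed.

Lemma affine_span_divring g : quadratic g -> divring_closed (affine_span g).
Proof.
move=> [a [b [Ka Kb g2]]].
have spanB : {in affine_span g &, forall x y, x - y \in affine_span g}.
  move=> x y /affine_spanP[c [d [Kc Kd ->]]] /affine_spanP
    [c' [d' [Kc' Kd' ->]]].
  by apply/affine_spanP; exists (c - c'), (d - d'); rewrite !rpredB //;
    split=> //; ring.
have spanM : {in affine_span g &, forall x y, x * y \in affine_span g}.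
  move=> x y /affine_spanP[c [d [Kc Kd ->]]] /affine_spanP
    [c' [d' [Kc' Kd' ->]]].
  apply/affine_spanP; exists (c * c' + d * d' * b),
    (c * d' + d * c' + d * d' * a).
  split; rewrite ?rpredD ?rpredM //.
  have -> : (c + d * g) * (c' + d' * g) =
    c * c' + (c * d' + d * c') * g + d * d' * g ^+ 2 by ring.
  by rewrite g2; ring.
have spanV : {in affine_span g, forall x, x^-1 \in affine_span g}.
  move=> x span_x; have /affine_spanP[c [d [Kc Kd xE]]] := span_x.
  (* [N] is the norm of [x], its product with the conjugate under [g |-> a - g]. *)
  pose N := c ^+ 2 + c * d * a - d ^+ 2 * b.
  have xN : x * (c + d * a - d * g) = N.
    have -> : x * (c + d * a - d * g) =
      c ^+ 2 + c * d * a + d ^+ 2 * a * g - d ^+ 2 * g ^+ 2 by rewrite xE; ring.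
    by rewrite g2 /N; ring.
  have KN : N \in K by rewrite rpredB ?rpredD ?rpredM ?rpredX.
  have span_conj : c + d * a - d * g \in affine_span g.
    by apply/affine_spanP; exists (c + d * a), (- d);
      rewrite rpredD ?rpredM ?rpredN ?mulNr.
  have [->|x0] := eqVneq x 0; first by rewrite invr0 affine_span_base ?rpred0.
  have [N0|N0] := eqVneq N 0; last first.
    have -> : x^-1 = N^-1 * (c + d * a - d * g).
      by apply: (mulfI x0); rewrite mulfV // mulrCA xN mulVf.
    by rewrite spanM // affine_span_base // rpredV.
  (* [g] may lie in [K], so a nonzero [x] can have norm 0; then the conjugate vanishes and [x]
     itself is in [K]. *)
  have /eqP := xN; rewrite N0 mulf_eq0 (negPf x0) subr_eq0 /= => /eqP dg.
  by rewrite affine_span_base // rpredV xE -dg !rpredD ?rpredM.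
split=> [||x y span_x span_y] //; first by rewrite affine_span_base ?rpred1.
by rewrite spanM ?spanV.
Qed.

Lemma quadratic_affine_span g x :
  quadratic g -> x \in affine_span g -> quadratic x.
Proof.
move=> [a [b [Ka Kb g2]]] /affine_spanP[c [d [Kc Kd ->]]].
(* The trace of [c + d * g] and minus its norm, for [g |-> a - g]. *)
exists (c *+ 2 + d * a), (d ^+ 2 * b - c ^+ 2 - c * d * a).
split; rewrite ?rpredB ?rpredD ?rpredM ?rpredMn ?rpredX //.
have -> : (c + d * g) ^+ 2 = c ^+ 2 + c * d * g *+ 2 + d ^+ 2 * g ^+ 2 by ring.
by rewrite g2; ring.
Qed.

End Quadratic.

(** * Assembling a root of unity from its prime-power parts *)

Section RootsOfUnity.

Variables (L : fieldType).

Lemma divring_root_of_unity (S : divringClosed L) (x : L) (n : nat) :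
    (0 < n)%N -> x ^+ n = 1 ->
    (forall p, p \in \pi(n) -> x ^+ (n %/ n`_p) \in S) ->
  x \in S.
Proof.
move=> n0 xn Sx.
(* The least d > 0 with [x ^+ d \in S] divides n and every [n %/ n`_p]. *)
have exd : exists d, (0 < d)%N && (x ^+ d \in S) by exists n;
  rewrite n0 xn rpred1.
case: (ex_minnP exd) => d /andP[d0 Sd] d_min.
have d_dvd j : x ^+ j \in S -> (d %| j)%N.
  move=> Sj; rewrite /dvdn eqn0Ngt; apply/negP => r0.
  suff /d_min : (0 < j %% d)%N && (x ^+ (j %% d) \in S)
    by rewrite leqNgt ltn_pmod.
  have x0 : x != 0 by apply: contra_eq_neq xn => ->;
    rewrite expr0n gtn_eqF // eq_sym oner_eq0.
  have -> : x ^+ (j %% d) = x ^+ j / x ^+ d ^+ (j %/ d).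
    by rewrite {2}(divn_eq j d) addnC exprD -exprM mulnC mulfK // expf_neq0.
  by rewrite r0 rpred_div // rpredX.
suff /eqP d1 : d == 1%N by rewrite d1 expr1 in Sd.
have dn : (d %| n)%N by apply: d_dvd; rewrite xn rpred1.
apply: contraT => d1.
have p_pr : prime (pdiv d) by rewrite pdiv_prime // ltn_neqAle eq_sym d1.
set p := pdiv d in p_pr.
have pd : (p %| d)%N by apply: pdiv_dvd.
have pn : p \in \pi(n) by rewrite mem_primes p_pr n0 (dvdn_trans pd dn).
have := dvdn_trans pd (d_dvd _ (Sx _ pn)).
have -> : (n %/ n`_p = n`_p^')%N by rewrite -{1}(partnC p n0) mulKn ?part_gt0.
have /pnatP := part_pnat p^' n; rewrite part_gt0 => /(_ isT) /(_ _ p_pr) h /h.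
by rewrite !inE eqxx.
Qed.

Lemma mem_prim_root (S : divringClosed L) n (u x : L) :
  n.-primitive_root u -> x ^+ n = 1 -> u \in S -> x \in S.
Proof. by move=> pu /(prim_rootP pu)[i ->] Su; rewrite rpredX. Qed.

End RootsOfUnity.

(** * Prime powers dividing (s - 1)(s + 1) *)

Lemma odd_prime_dvdn_pred_succ p f s : prime p -> p != 2%N -> (0 < s)%N ->
  (p ^ f %| s.-1 * s.+1)%N -> (p ^ f %| s.-1)%N || (p ^ f %| s.+1)%N.
Proof.
move=> p_pr p2 s0; have [ps|ps] := boolP (p %| s.-1)%N.
  rewrite Gauss_dvdl ?coprimeXl ?prime_coprime // => [->//|].
  by rewrite -{1}(prednK s0) -addn2 dvdn_addr // dvdn_prime2.
by rewrite Gauss_dvdr ?coprimeXl ?prime_coprime // => ->; rewrite orbT.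
Qed.

(** Unlike an odd prime, 2 may divide both factors; then one of them is twice an odd number, which
    costs a single factor 2. *)
Lemma two_dvdn_pred_succ f s : (0 < s)%N ->
  (2 ^ f %| s.-1 * s.+1)%N -> (2 ^ f %| 2 * s.-1)%N || (2 ^ f %| 2 * s.+1)%N.
Proof.
case: s => // k _ /=; have [k_odd|k_even] := boolP (odd k).
  rewrite Gauss_dvdr ?coprimeXl ?coprime2n // => k2.
  by rewrite [X in _ || X]dvdn_mull ?orbT.
have [r ->] : exists r, k = (2 * r)%N by exists k./2; rewrite mul2n even_halfK.
have [r_odd|r_even] := boolP (odd r).
  rewrite -mulnA mulnCA Gauss_dvdr ?coprimeXl ?coprime2n // => k2.
  by rewrite k2 orbT.
have -> : (2 * r * (2 * r).+2 = r.+1 * (2 * (2 * r)))%N by lia.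
by rewrite Gauss_dvdr ?coprimeXl ?coprime2n //= => ->.
Qed.

(** * The action of quadratic conjugation on roots of unity *)

Section Conjugation.

Variables (L : fieldType) (K : divringClosed L).

Lemma affine_in_base c d (z : L) :
  z \notin K -> c \in K -> d \in K -> (c + d * z \in K) = (d == 0).
Proof.
move=> Kz Kc Kd; rewrite rpredDl //; have [->|d0] := eqVneq d 0.
  by rewrite mul0r rpred0.
by apply: contraNF Kz => Kdz; rewrite -(mulKf d0 z) rpredM ?rpredV.
Qed.

(* The nontrivial K-automorphism of a quadratic extension of K containing the
   n-th roots of unity acts on them as [u |-> u ^+ s]. *)
Definition conjugation_exponent (n s : nat) : Prop :=
  [/\ (0 < s)%N, (n %| s.-1 * s.+1)%N
    & forall e u v, e \in K -> u ^+ n = 1 -> v ^+ n = 1 ->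
        (u + e * v \in K) = (u ^+ s + e * v ^+ s == u + e * v)].

(** No automorphism is constructed: conjugation replaces [z] by the other root [z' = a - z] and
    keeps coordinates over [K]. Since [z'] is again an n-th root of unity, it is a power of [z], and
    [s] is the exponent. *)
Lemma quadratic_conjugation n z :
    n.-primitive_root z -> z \notin K -> quadratic K z ->
  exists s, conjugation_exponent n s.
Proof.
move=> pz Kz [a [b [Ka Kb z2]]]; pose z' := a - z.
have z'2 : z' ^+ 2 = a * z' + b.
  have -> : z' ^+ 2 = a ^+ 2 - a * z *+ 2 + z ^+ 2 by rewrite /z'; ring.
  by rewrite z2 /z'; ring.
have powE j : exists c d,
    [/\ c \in K, d \in K, z ^+ j = c + d * z & z' ^+ j = c + d * z'].
  elim: j => [|j [c [d [Kc Kd zj z'j]]]].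
    by exists 1, 0; rewrite !expr0 !mul0r !addr0 rpred0 rpred1.
  exists (d * b), (c + d * a); split; rewrite ?rpredD ?rpredM //.
    have -> : z ^+ j.+1 = c * z + d * z ^+ 2 by rewrite exprSr zj; ring.
    by rewrite z2; ring.
  have -> : z' ^+ j.+1 = c * z' + d * z' ^+ 2 by rewrite exprSr z'j; ring.
  by rewrite z'2; ring.
(* Separability. If [z' = z] then [a = 2z], which puts [z] in [K] unless the characteristic is 2;
   there [n] is odd and [z] is a power of [z ^+ 2 = b]. *)
have zz' : z' - z != 0.
  rewrite subr_eq0; apply: contra Kz; rewrite subr_eq -mulr2n -mulr_natl =>
    /eqP aE.
  have [two0|two0] := eqVneq (2%:R : L) 0; last first.
    by rewrite -(mulKf two0 z) -aE rpredM ?rpredV ?rpred_nat.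
  have n_odd : odd n.
    rewrite -[odd n]negbK -dvdn2; apply/negP => /(prim_root_pcharF pz).
    by rewrite inE two0 eqxx.
  have -> : z = (z ^+ 2) ^+ (n.+1)./2.
    by rewrite -exprM mulnC muln2 -[LHS]mul1r -(prim_expr_order pz) -exprSr
      (even_halfK (n := n.+1)) /= ?n_odd.
  by rewrite rpredX // z2 aE two0 !mul0r add0r.
(* [z ^+ n = 1] has no [z]-coordinate, and [z' ^+ n] has the same coordinates. *)
have z'n : z' ^+ n = 1.
  have [c [d [Kc Kd zn ->]]] := powE n.
  move: zn; rewrite (prim_expr_order pz) => zn.
  have /eqP d0 : d == 0 by rewrite -(affine_in_base Kz Kc Kd) -zn rpred1.
  by move: zn; rewrite d0 !mul0r.
have [i z'E] := prim_rootP pz z'n; exists i; set s := nat_of_ord i in z'E *.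
have s0 : (0 < s)%N.
  rewrite lt0n; apply: contra Kz => /eqP s0.
  by rewrite -(subKr a z) -/z' z'E s0 rpredB ?rpred1.
split=> [//||e u v Ke un vn].
  (* Conjugating twice returns [z], so [z ^+ (s * s) = z], and [s * s] is the successor of
     [s.-1 * s.+1]. *)
  rewrite (prim_order_dvd pz).
  have [c [d [Kc Kd zs z's]]] := powE s.
  have d1 : d + 1 = 0.
    have Kd1 : d + 1 \in K by rewrite rpredD ?rpred1.
    apply/eqP; rewrite -(affine_in_base Kz Kc Kd1).
    by rewrite mulrDl mul1r addrA -zs -z'E /z' subrK.
  have z's' : z' ^+ s = z.
    have dE : d = -1 by apply/eqP; rewrite -addr_eq0 d1.
    have cE : c = a.
      by move: zs; rewrite -z'E dE mulN1r /z' => /addIr.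
    by rewrite z's dE cE mulN1r /z' subKr.
  have z0 : z != 0 by apply: contra Kz => /eqP ->; rewrite rpred0.
  rewrite -(inj_eq (mulIf z0)) mul1r -exprSr.
  have -> : ((s.-1 * s.+1).+1 = s * s)%N.
    by case: (s) s0 => // k _ /=; rewrite !mulnS !mulSn -!addnS; lia.
  by rewrite exprM -z'E z's'.
have [j ->] := prim_rootP pz un; have [k ->] := prim_rootP pz vn.
rewrite -!exprM ![(_ * s)%N]mulnC !exprM -z'E.
have [c [d [Kc Kd -> ->]]] := powE j; have [c' [d' [Kc' Kd' -> ->]]] := powE k.
have -> x : c + d * x + e * (c' + d' * x) = (c + e * c') + (d + e * d') * x
  by ring.
rewrite affine_in_base ?rpredD ?rpredM // [c + d * z' + _](_ : _ =
  (c + e * c') + (d + e * d') * z'); last by ring.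
(* The values at [z'] and [z] differ by [(d + e * d') * (z' - z)]. *)
by rewrite -[RHS]subr_eq0 opprD addrACA subrr add0r -mulrBr mulf_eq0
  (negPf zz') orbF.
Qed.

Section ConjugationExponent.

Variables (n s : nat) (u : L).
Hypothesis conj_s : conjugation_exponent n s.
Hypothesis un : u ^+ n = 1.

Lemma conjugation_fixed : (u \in K) = (u ^+ s == u).
Proof.
have [_ _ /(_ 0 u u (rpred0 K) un un)] := conj_s.
by rewrite !mul0r !addr0.
Qed.

Lemma conjugation_inv e : e \in K ->
  (u + e * u^-1 \in K) = (u ^+ s + e * (u ^+ s)^-1 == u + e * u^-1).
Proof.
move=> Ke; have [_ _ conjE] := conj_s.
by rewrite conjE // exprVn // un invr1.
Qed.

(** The map x |-> x - 1/x takes the same value only at x and -1/x. Conjugation fixes this value and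
    moves [u], so it sends [u] to [- u^-1]. *)
Lemma conjugation_sub_inv :
  u \notin K -> u - u^-1 \in K -> u ^+ s.+1 = -1.
Proof.
move=> Ku; have u0 : u != 0 by apply: contra Ku => /eqP ->; rewrite rpred0.
have us0 : u ^+ s != 0 by rewrite expf_neq0.
rewrite -[- u^-1]mulN1r conjugation_inv ?rpredN ?rpred1 // -subr_eq0.
have -> : u ^+ s + -1 * (u ^+ s)^-1 - (u + -1 * u^-1) =
    (u ^+ s - u) * (u ^+ s.+1 + 1) / u ^+ s.+1.
  by rewrite exprS; field; rewrite u0 us0.
rewrite !mulf_eq0 invr_eq0 expf_eq0 (negPf u0) andbF orbF subr_eq0.
by rewrite -conjugation_fixed (negPf Ku) addr_eq0 => /eqP.
Qed.

(** Conjugation sends [u] to [u^-1], so it exchanges the two summands. *)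
Lemma conjugation_add_inv_mem : u ^+ s.+1 = 1 -> u + u^-1 \in K.
Proof.
move=> us; have u0 : u != 0.
  by apply: contra_eq_neq us => ->; rewrite expr0n eq_sym oner_eq0.
rewrite -[u^-1]mul1r conjugation_inv ?rpred1 //.
have -> : u ^+ s = u^-1 by apply: (mulfI u0); rewrite -exprS us mulfV.
by rewrite invrK !mul1r addrC.
Qed.

Lemma conjugation_sub_inv_mem : u ^+ s.+1 = -1 -> u - u^-1 \in K.
Proof.
move=> us; have u0 : u != 0.
  by apply: contra_eq_neq us => ->; rewrite expr0n eq_sym oppr_eq0 oner_eq0.
rewrite -[- u^-1]mulN1r conjugation_inv ?rpredN ?rpred1 //.
have -> : u ^+ s = - u^-1 by apply: (mulfI u0); rewrite -exprS us mulrN mulfV.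
by rewrite invrN invrK !mulN1r opprK addrC.
Qed.

End ConjugationExponent.

End Conjugation.

(** * Degree two over F as a quadratic equation *)

Section BaseField.

Variables (F L : fieldType) (iota : {rmorphism F -> L}).

Definition base_image : {pred L} := fun x => `[< range iota x >].

Lemma base_imageP x : reflect (exists a, x = iota a) (x \in base_image).
Proof. by apply: (iffP (asboolP _)) => [[a _ <-]|[a ->]]; exists a. Qed.

Lemma base_image_iota a : iota a \in base_image.
Proof. by apply/base_imageP; exists a. Qed.

Lemma base_image_divring : divring_closed base_image.
Proof.
split=> [|x y /base_imageP[a ->] /base_imageP[b ->]|x y /base_imageP[a ->]
  /base_imageP[b ->]];
  apply/base_imageP; first by exists 1; rewrite rmorph1.
- by exists (a - b); rewrite rmorphB.
- by exists (a / b); rewrite fmorph_div.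
Qed.

HB.instance Definition _ :=
  GRing.isDivringClosed.Build L base_image base_image_divring.

Variable z : L.

Local Notation A := (adjoin iota [set z]%classic).
Let Z : A := Adjoin (gen_in_adjoin iota (erefl : [set z]%classic z)).

Lemma adjoin_subset (S : divringClosed L) (x : A) :
  (forall a, iota a \in S) -> z \in S -> val x \in S.
Proof. by case: x => x /= /asboolP Sx SF Sz; apply: Sx => // _ ->. Qed.

Lemma val_adjoin_scale (a : F) (x : A) : val (a *: x) = iota a * val x.
Proof. by []. Qed.

(** If [z] is in F, every element of F(z) is a scalar multiple of 1, so both unit vectors of F^2
    would be multiples of the image of 1. *)
Lemma adjoin_degree2_notin : adjoin_degree_is iota [set z]%classic 2 ->
  z \notin base_image.
Proof.
case=> -[f flin [g fK gK]]; apply/negP => Fz.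
pose fL : {linear A -> 'rV[F]_2} := HB.pack f (GRing.isLinear.Build
  _ _ _ _ f flin).
have scalar (x : A) : exists c : F, x = c *: (1 : A).
  have /base_imageP[c xc] : val x \in base_image.
    by apply: adjoin_subset Fz => a; apply: base_image_iota.
  by exists c; apply: val_inj; rewrite xc val_adjoin_scale rmorph1 mulr1.
have [c0 x0] := scalar (g (delta_mx 0 0));
  have [c1 x1] := scalar (g (delta_mx 0 1)).
have e0 : delta_mx 0 0 = c0 *: fL 1 by rewrite -linearZ -x0 /= gK.
have e1 : delta_mx 0 1 = c1 *: fL 1 by rewrite -linearZ -x1 /= gK.
have /matrixP E : c1 *: delta_mx 0 0 = c0 *: delta_mx 0 1 :> 'rV[F]_2.
  by rewrite e0 e1 !scalerA mulrC.
have := E 0 1; rewrite !mxE /= mulr1 mulr0 => c00.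
by move/matrixP: e0 => /(_ 0 0); rewrite !mxE /= -c00 mul0r => /eqP;
  rewrite oner_eq0.
Qed.

(** The vectors 1, [Z], [Z ^+ 2] are dependent in dimension 2; a relation is a kernel vector of the
    matrix [M] of their coordinates. *)
Lemma adjoin_degree2_quadratic :
  adjoin_degree_is iota [set z]%classic 2 -> quadratic base_image z.
Proof.
move=> deg2; have Fz := adjoin_degree2_notin deg2; case: deg2 =>
  -[f flin [g fK gK]].
pose fL : {linear A -> 'rV[F]_2} := HB.pack f (GRing.isLinear.Build
  _ _ _ _ f flin).
pose M : 'M[F]_(3, 2) := \matrix_(i < 3) fL (Z ^+ i).
have /rowV0Pn[v /sub_kermxP vM v0] : kermx M != 0.
  by rewrite kermx_eq0 /row_free neq_ltn ltnS (rank_leq_col M).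
have : fL (\sum_(i < 3) v 0 i *: Z ^+ i) = 0.
  rewrite linear_sum -[RHS]vM mulmx_sum_row; apply: eq_bigr => i _.
  by rewrite linearZ rowK.
rewrite -(linear0 fL) => /(can_inj fK)/(congr1 val).
pose c k := v 0 (inord k).
have -> : \sum_(i < 3) v 0 i *: Z ^+ i = \sum_(i < 3) c i *: Z ^+ i.
  by apply: eq_bigr => i _; rewrite /c inord_val.
rewrite !big_ord_recr big_ord0 /= add0r mulr1 => relZ.
have {}relZ : iota (c 0) + iota (c 1) * z + iota (c 2) * z ^+ 2 = 0.
  by rewrite -relZ !expr2.
have [c2|c2] := eqVneq (c 2) 0; last first.
  exists (iota (- c 1 / c 2)), (iota (- c 0 / c 2)); rewrite !base_image_iota;
    split=> //.
  rewrite !fmorph_div !rmorphN; apply/eqP;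
    rewrite -subr_eq0 -(mulrI_eq0 _ (mulfI (_ : iota (c 2) != 0))) ?fmorph_eq0
      //.
  by apply/eqP; rewrite -[RHS]relZ; field; rewrite fmorph_eq0.
(* Without a quadratic term, [Fz] forces the other two coefficients to vanish as well, against
   [v0]. *)
move: relZ; rewrite c2 rmorph0 mul0r addr0 => relZ.
have /eqP c1 : iota (c 1) == 0.
  by rewrite -(affine_in_base Fz (base_image_iota (c 0))) ?base_image_iota //
    relZ rpred0.
move: relZ; rewrite c1 mul0r addr0 => /eqP; rewrite fmorph_eq0 => /eqP c0.
move/eqP: c1; rewrite fmorph_eq0 => /eqP c1.
case/eqP: v0; apply/rowP => i; rewrite mxE -[i]inord_val.
by case: i => -[|[|[|]]].
Qed.

Lemma adjoin_degree2P :
  adjoin_degree_is iota [set z]%classic 2 <->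
  z \notin base_image /\ quadratic base_image z.
Proof.
split=> [deg2|[Fz quad_z]].
  by split; [apply: adjoin_degree2_notin | apply: adjoin_degree2_quadratic].
pose span : divringClosed L := HB.pack (affine_span base_image z)
  (GRing.isDivringClosed.Build L _ (affine_span_divring quad_z)).
pose h (v : 'rV[F]_2) : A := v 0 0 *: (1 : A) + v 0 1 *: Z.
have valh v : val (h v) = iota (v 0 0) + iota (v 0 1) * z by rewrite /= mulr1.
have hlin : linear h.
  move=> a u v; apply: val_inj;
    rewrite -[RHS]/(val (a *: h u) + val (h v)) val_adjoin_scale !valh.
  by rewrite !mxE !rmorphD !rmorphM; ring.
(* The affine span of [z] is a subfield, so it contains all of F(z). *)
have hsurj x : exists v, h v = x.
  have : val x \in span.
    apply: adjoin_subset; last exact: affine_span_gen.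
    by move=> a; apply: affine_span_base; apply: base_image_iota.
  move=> /affine_spanP[_ [_ [/base_imageP[c ->] /base_imageP[d ->] xE]]].
  exists (\row_i if i == 0 then c else d); apply: val_inj.
  by rewrite valh !mxE xE.
pose hL : {linear 'rV[F]_2 -> A} := HB.pack h (GRing.isLinear.Build
  _ _ _ _ h hlin).
have hinj : injective hL.
  apply: raddf_inj => v /(congr1 val); rewrite [LHS]valh => /eqP v0.
  have /eqP v1 : iota (v 0 1) == 0.
    by rewrite -(affine_in_base Fz (base_image_iota (v 0 0))) ?base_image_iota
      // (eqP v0) rpred0.
  move: v0; rewrite v1 mul0r addr0 fmorph_eq0 => /eqP v0.
  apply/rowP => i; rewrite mxE; case: (unliftP 0 i) => [j|] -> //.
  have -> : lift 0 j = 1 by rewrite ord1; apply: val_inj.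
  by apply/eqP; rewrite -(fmorph_eq0 iota) v1.
have [k kK] := choice hsurj.
constructor; exists k; last by exists h => // v; apply: hinj; exact: kK.
by move=> a x y; apply: hinj; rewrite linearP /= !kK.
Qed.

End BaseField.

(** Only the factor at [p] contributes to the p-part; this recovers [t_primepow] from [t_fun]. *)
Lemma partn_prod_primes (s : seq nat) (f : nat -> nat) (p : nat) :
    uniq s -> (forall q, q \in s -> q.-nat (f q)) ->
  ((\prod_(q <- s) f q)`_p = if p \in s then f p else 1)%N.
Proof.
elim: s => [|q s IH] /=; first by rewrite big_nil partn1.
move=> /andP[qs s_uniq] f_nat; rewrite big_cons inE.
have f_natq : q.-nat (f q) by rewrite f_nat ?inE ?eqxx.
have f_nats r : r \in s -> r.-nat (f r) by move=> rs;
  rewrite f_nat ?inE ?rs ?orbT.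
have prod_gt0 : (0 < \prod_(r <- s) f r)%N.
  by rewrite big_seq prodn_cond_gt0 // => r /f_nats/andP[].
have f_gt0 : (0 < f q)%N by case/andP: f_natq.
rewrite partnM // IH //; have [->|pq] := eqVneq p q.
  by rewrite (negPf qs) muln1 part_pnat_id.
rewrite part_p'nat ?mul1n //; apply: sub_in_pnat f_natq => r _.
by rewrite !inE => /eqP ->; rewrite eq_sym.
Qed.

(** * The function t_F and the vanishing of kappa *)

Section Kappa.

Variables (F : fieldType) (L : closedFieldType) (iota : {rmorphism F -> L}).
Variable zeta : nat -> mu_infty L.
Hypothesis zeta_prim : is_primitive_choice F zeta.

Local Notation K := (base_image iota).
Local Notation order_over := (order_over iota).
Local Notation t_primepow := (t_primepow iota zeta).
Local Notation t_fun := (t_fun iota zeta).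

(** The existence of a primitive n-th root already makes [n], hence [d], prime to the
    characteristic. *)
Lemma prim_zeta n d (z : L) :
  n.-primitive_root z -> (d %| n)%N -> d.-primitive_root (val (zeta d)).
Proof.
move=> /pchar_prim_root n_nat dn; apply: zeta_prim; apply: pnat_dvd dn _.
by rewrite -(eq_pnat _ (eq_negn (fmorph_pchar iota))).
Qed.

Lemma mu_order_prim (z : mu_infty L) : (mu_order z).-primitive_root (val z).
Proof.
have [n n0 zn] : mu_infty L (val z) by apply: set_valP.
have [m pm _] := prim_order_exists n0 zn.
by apply: (@xgetPex _ 0%N [set n | n.-primitive_root (val z)]%classic);
  exists m.
Qed.

Lemma order_overP (z : mu_infty L) :
  [/\ (0 < order_over z)%N, val z ^+ order_over z \in K
    & forall j, (0 < j)%N -> val z ^+ j \in K -> (order_over z <= j)%N].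
Proof.
pose P := [set k | [/\ (0 < k)%N, range iota (val z ^+ k)
  & forall j, (0 < j)%N -> range iota (val z ^+ j) -> (k <= j)%N]]%classic.
have [k0 /asboolP kK kmin] : P (order_over z).
  (* Some power of [z] is 1, so the minimum exists and [xget] does not fall back on 0. *)
  apply: xgetPex; have [n n0 zn] : mu_infty L (val z) by apply: set_valP.
  have exk : exists k, (0 < k)%N && (val z ^+ k \in K).
    by exists n; rewrite n0 zn rpred1.
  case: (ex_minnP exk) => k /andP[k0 kK] kmin; exists k; split=> // [|j j0 jK].
    exact/asboolP.
  by apply: kmin; rewrite j0; apply/asboolP.
by split=> // j j0 /asboolP; apply: kmin.
Qed.

Lemma order_over_eq1 z : (order_over z == 1%N) = (val z \in K).
Proof.
have [o0 oK omin] := order_overP z; apply/eqP/idP => [o1|zK].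
  by rewrite o1 in oK.
by apply/eqP; rewrite eqn_leq o0 omin.
Qed.

Lemma order_over_eq2 z :
  (order_over z == 2%N) = (val z \notin K) && (val z ^+ 2 \in K).
Proof.
rewrite -order_over_eq1; have [o0 oK omin] := order_overP z.
apply/eqP/andP => [o2|[o1 z2]]; first by rewrite o2 in oK *.
by apply/eqP; rewrite eqn_leq omin //= ltn_neqAle eq_sym o1.
Qed.

Lemma t_primepowE p e : t_primepow p e =
  if val (zeta (p ^ e)%N) \in K then 1%N
  else if (p == 2%N) && (val (zeta (p ^ e)%N) ^+ 2 \in K) then 2%N
  else (p ^ e)%N.
Proof.
rewrite /t_primepow order_over_eq1; case: ifP => // zK.
by rewrite order_over_eq2 zK; case: eqP => //= ->.
Qed.

Lemma t_primepow_pnat p e : prime p -> p.-nat (t_primepow p e).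
Proof.
move=> p_pr; rewrite t_primepowE; case: ifP => // _.
by case: ifP => [/andP[/eqP -> _]|_]; rewrite // pnatX pnat_id.
Qed.

Lemma part_t_fun n p : p \in primes n -> ((t_fun n)`_p)%N =
  t_primepow p (logn p n).
Proof.
move=> pn; rewrite /t_fun partn_prod_primes ?primes_uniq ?pn // => q.
by rewrite mem_primes => /andP[q_pr _]; apply: t_primepow_pnat.
Qed.

Lemma t_fun_gt0 n : (0 < t_fun n)%N.
Proof.
rewrite /t_fun big_seq prodn_cond_gt0 // => q; rewrite mem_primes =>
  /andP[q_pr _].
by have /andP[] := t_primepow_pnat (logn q n) q_pr.
Qed.

Lemma primes_t_fun n p : p \in primes (t_fun n) -> p \in primes n.
Proof.
apply: contraLR => pn;
  rewrite -p_part_eq1 /t_fun partn_prod_primes ?primes_uniq //.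
  by rewrite (negPf pn).
by move=> q; rewrite mem_primes => /andP[q_pr _]; apply: t_primepow_pnat.
Qed.

Lemma t_fun_dvd n : (t_fun n %| n)%N.
Proof.
apply/dvdn_partP => [|p /primes_t_fun pn]; first exact: t_fun_gt0.
rewrite part_t_fun // t_primepowE; case: ifP => _; first exact: dvd1n.
case: ifP => [/andP[/eqP p2 _]|_]; last exact: pfactor_dvdnn.
by move: pn; rewrite p2 mem_primes => /and3P[].
Qed.

Lemma coset_base_eq0 A (x : adjoin iota A) :
  (coset_base x = coset_base 0) <-> val x \in K.
Proof.
rewrite /coset_base; split=> [/eqP|Kx].
  rewrite -Quotient.idealrBE subr0 => /asboolP[a _ <-]; exact: base_image_iota.
apply/eqP; rewrite -Quotient.idealrBE subr0; apply/asboolP.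
by have /base_imageP[a xa] := Kx; exists a => //; apply: val_inj.
Qed.

Lemma kappa_eq0 z :
  let n := mu_order z in let e := logn 2 n in
  let y := val (zeta (t_fun n)) in let w := val (zeta (2 ^ e)%N) in
  kappa iota zeta z = zero_map iota z <->
  (if order_over (zeta (2 ^ e)%N) != 2%N then
     if ~~ `[< is_c2 iota zeta e >] then y + y^-1 else y - y^-1
   else w * (y - y^-1)) \in K.
Proof.
move=> n e y w; rewrite /kappa /zero_map -/n -/e.
by case: ifP => _; [case: ifP => _|];
  rewrite coset_base_eq0 ?rmorphM ?rmorphB ?rmorphD /= ?fmorphV.
Qed.


(** If [p] does not divide [n], the exponent is 0 and the root is 1, which lies in [K]. *)
Lemma notin_base_primes n (x : L) p : n.-primitive_root x -> prime p ->
  val (zeta (p ^ logn p n)%N) \notin K -> p \in primes n.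
Proof.
move=> px p_pr; rewrite mem_primes p_pr (prim_order_gt0 px);
  apply: contraNT => pn.
have /prim_expr_order := prim_zeta px (pfactor_dvdnn p n).
by rewrite lognE p_pr (prim_order_gt0 px) (negPf pn) expr1 => ->;
  rewrite rpred1.
Qed.

(** * From the vanishing of kappa to degree at most two *)

Lemma quadratic_of_gens g z : quadratic K g ->
    (forall p, p \in primes (mu_order z) ->
       val (zeta (p ^ logn p (mu_order z))%N) \in affine_span K g) ->
  quadratic K (val z).
Proof.
move=> quad_g gens; have pz := mu_order_prim z; set n := mu_order z in gens pz.
pose S : divringClosed L := HB.pack (affine_span K g)
  (GRing.isDivringClosed.Build L _ (affine_span_divring quad_g)).
apply: (quadratic_affine_span quad_g); rewrite -[_ \in _]/(val z \in S).
have n0 := prim_order_gt0 pz.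
apply: (divring_root_of_unity n0 (prim_expr_order pz)) => p pn.
apply: (mem_prim_root (prim_zeta pz (pfactor_dvdnn p n))); last exact: gens.
by rewrite -p_part -exprM divnK ?dvdn_part // prim_expr_order.
Qed.

(** The chosen root for each prime power in [n] lies in [K], or is a power of [zeta (t_fun n)]
    because its order divides [t_fun n], or is [w] with its contribution to [t_fun n] cut down to 2.
    Only the last case calls on [w]. *)
Lemma quadratic_of_kappa_gens g z :
    let n := mu_order z in let w := zeta (2 ^ logn 2 n)%N in
    quadratic K g -> val (zeta (t_fun n)) \in affine_span K g ->
    (order_over w = 2%N -> val w \in affine_span K g) ->
  quadratic K (val z).
Proof.
move=> n w quad_g gy gw; apply: (quadratic_of_gens quad_g) => p pn; rewrite -/n.
have pz : n.-primitive_root (val z) := mu_order_prim z.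
have := part_t_fun pn; rewrite t_primepowE; set u := val _.
case: ifP => [Ku _|Ku]; first exact: affine_span_base.
case: ifP => [/andP[/eqP p2 Ku2] _|_ tp].
  rewrite p2 in u Ku Ku2 *; apply/gw/eqP.
  by rewrite order_over_eq2 -/u Ku Ku2.
pose S : divringClosed L := HB.pack (affine_span K g)
  (GRing.isDivringClosed.Build L _ (affine_span_divring quad_g)).
rewrite -[_ \in _]/(u \in S).
have py := prim_zeta pz (t_fun_dvd n).
apply: (mem_prim_root (S := S) py _ gy); apply/eqP.
have pu : (p ^ logn p n).-primitive_root u
  by rewrite (prim_zeta pz) ?pfactor_dvdnn.
by rewrite -(prim_order_dvd pu) -tp dvdn_part.
Qed.

Lemma kappa_eq0_quadratic z : kappa iota zeta z = zero_map iota z ->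
  val z \notin K -> quadratic K (val z).
Proof.
move/kappa_eq0; have := @quadratic_of_kappa_gens _ z.
have pz := mu_order_prim z; set n := mu_order z in pz *.
set y := val (zeta (t_fun n)); set w := val (zeta (2 ^ logn 2 n)%N).
move=> quad_z; have py : (t_fun n).-primitive_root y := prim_zeta pz
  (t_fun_dvd n).
have y0 : y != 0.
  by rewrite (prim_root_eq0 py) -lt0n t_fun_gt0.
case: ifP => [/eqP o2|/negbFE].
  move=> KE _; apply: (quad_z y); [|exact: affine_span_gen|by move/o2].
  case: ifP KE => _ KE.
    exists (y + y^-1), (-1); rewrite KE rpredN rpred1; split=> //.
    by field.
  exists (y - y^-1), 1; rewrite KE rpred1; split=> //.
  by field.
rewrite order_over_eq2 -/w => /andP[Kw Kw2] KE Kz.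
have w0 : w != 0 by apply: contra Kw => /eqP ->; rewrite rpred0.
(* If [y] is 1 or -1, the field is generated by [w], whose square is in [K]. *)
have [y2|y2] := eqVneq (y ^+ 2) 1.
  apply: (quad_z w) => [||_]; last exact: affine_span_gen.
    by exists 0, (w ^+ 2); rewrite Kw2 rpred0 mul0r add0r.
  by apply: affine_span_base; move/eqP: y2; rewrite sqrf_eq1 => /pred2P[] yE;
    rewrite -/y yE ?rpredN rpred1.
have yV : y - y^-1 != 0.
  apply: contra y2; rewrite subr_eq0 => /eqP yV.
  by rewrite -(mulVf y0) -yV.
set v := y ^+ 2.
have Kv : v + v^-1 \in K.
  (* [v + v^-1] is [(y - y^-1) ^+ 2 + 2]. *)
  have -> : v + v^-1 = (w * (y - y^-1)) ^+ 2 / w ^+ 2 + 2%:R.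
    by rewrite /v; field; rewrite y0 w0.
  by rewrite rpredD ?rpred_nat // rpred_div // rpredX.
have quad_v : quadratic K v.
  exists (v + v^-1), (-1); rewrite Kv rpredN rpred1; split=> //.
  by field; rewrite expf_neq0.
pose S : divringClosed L := HB.pack (affine_span K v)
  (GRing.isDivringClosed.Build L _ (affine_span_divring quad_v)).
(* [y] has order 2m with m odd, so [v ^+ m.+1 = y ^+ 2] and [y] is a power of [v] up to sign. *)
have Sy : y \in S.
  have n2 := notin_base_primes pz (isT : prime 2) Kw.
  have t2 : ((t_fun n)`_2 = 2)%N
    by rewrite part_t_fun // t_primepowE -/w (negPf Kw) Kw2.
  have tE : t_fun n = (2 * (t_fun n)`_2^')%N
    by rewrite -{1}(partnC 2%N (t_fun_gt0 n)) t2.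
  have m_odd : odd ((t_fun n)`_2^')%N by rewrite -coprime2n;
    apply: (@pnat_coprime 2%N); [exact: pnat_id | exact: part_pnat].
  set m := ((t_fun n)`_2^')%N in tE m_odd.
  have : y ^+ 2 == (v ^+ m.+1./2) ^+ 2.
    rewrite -exprM muln2 even_halfK /= ?negbK //.
    by rewrite [v ^+ _]exprSr -exprM -tE (prim_expr_order py) mul1r.
  have Sv : v \in S by exact: affine_span_gen.
  by rewrite eqf_sqr => /pred2P[] ->; rewrite ?rpredN rpredX.
apply: (quad_z v) => // _; rewrite -[_ \in _]/(w \in S).
(* Dividing the representative of kappa by [y - y^-1] recovers [w]. *)
rewrite -(mulfK yV w) rpred_div ?rpredB ?rpredV //.
exact: affine_span_base.
Qed.

(** * Uniqueness of c_2, and from degree two to the vanishing of kappa *)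

Lemma c2_spec_is_c2 e : c2_spec iota zeta e -> is_c2 iota zeta e.
Proof.
(* For e1 < e2, u1 is an even power of u2, so conjugation, which sends u2 to
   [- u2^-1], sends u1 to [u1^-1] rather than [- u1^-1]. *)
suff c2_lt e1 e2 : (e1 < e2)%N -> c2_spec iota zeta e1 ->
  c2_spec iota zeta e2 -> False.
  move=> c2e; split=> // e' c2e'; case: (ltngtP e e') => // lt_e.
    by case: (c2_lt _ _ lt_e c2e c2e').
  by case: (c2_lt _ _ lt_e c2e' c2e).
move=> lt_e [e1_gt0 ch1 /asboolPn Ku1 _ /asboolP Ku1V]
  [e2_gt0 ch2 /asboolPn Ku2 _ /asboolP Ku2V].
have pu1 := zeta_prim ch1; have pu2 := zeta_prim ch2.
set u1 := val (zeta (2 ^ e1)%N) in pu1 Ku1 Ku1V;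
  set u2 := val (zeta (2 ^ e2)%N) in pu2 Ku2 Ku2V.
rewrite -[`[< _ >]]/(u1 \in K) in Ku1; rewrite -[`[< _ >]]/(u2 \in K) in Ku2.
rewrite -[`[< _ >]]/(u1 - u1^-1 \in K) in Ku1V;
  rewrite -[`[< _ >]]/(u2 - u2^-1 \in K) in Ku2V.
have u2_neq0 : u2 != 0 by rewrite (prim_root_eq0 pu2) -lt0n expn_gt0.
have [|s conj_s] := quadratic_conjugation pu2 Ku2.
  by exists (u2 - u2^-1), 1; rewrite Ku2V rpred1; split=> //; field.
have s2 := conjugation_sub_inv conj_s (prim_expr_order pu2) Ku2 Ku2V.
have u1n : u1 ^+ (2 ^ e2) = 1.
  by apply/eqP; rewrite -(prim_order_dvd pu1) dvdn_exp2l // ltnW.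
have s1 := conjugation_sub_inv conj_s u1n Ku1 Ku1V.
have [i u1E] : exists i, u1 = (u2 ^+ 2) ^+ i.
  have pu2' := dvdn_prim_root pu2 (dvdn_exp2l 2 (ltnW lt_e)).
  have [i ->] := prim_rootP pu2' (prim_expr_order pu1).
  exists (2 ^ (e2 - e1).-1 * i)%N.
  by rewrite -!exprM -expnB ?(ltnW lt_e) // mulnA -expnS prednK ?subn_gt0.
have u1s : u1 ^+ s.+1 = (u2 ^+ s.+1) ^+ 2 ^+ i.
  by rewrite u1E -!exprM; congr (_ ^+ _); lia.
(* This gives 1 = -1, but a primitive root of even order excludes characteristic 2. *)
move: s1; rewrite u1s s2 sqrrN !expr1n => /eqP.
by rewrite -addr_eq0 -(natrD _ 1 1) (negPf (prim_root_dvd_eq0 pu2 (dvdn_exp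
  e2_gt0 (dvdnn 2)))).
Qed.

Lemma quadratic_kappa_eq0 z :
  val z \notin K -> quadratic K (val z) -> kappa iota zeta z = zero_map iota z.
Proof.
move=> Kz quad_z; apply/kappa_eq0; have pz := mu_order_prim z.
set n := mu_order z in pz *; set t := t_fun n.
set y := val (zeta t); set e := logn 2 n; set w := val (zeta (2 ^ e)%N).
have [s conj_s] := quadratic_conjugation pz Kz quad_z.
have [s0 n_dvd _] := conj_s.
have py : t.-primitive_root y := prim_zeta pz (t_fun_dvd n).
have yn : y ^+ n = 1 by apply/eqP; rewrite -(prim_order_dvd py) t_fun_dvd.
have e_dvd : (2 ^ e %| n)%N by apply: pfactor_dvdnn.
have pw : (2 ^ e).-primitive_root w by apply: (prim_zeta pz).
have wn : w ^+ n = 1 by apply/eqP; rewrite -(prim_order_dvd pw).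
have y0 : y != 0 by rewrite (prim_root_eq0 py) -lt0n t_fun_gt0.
(* A prime dividing [t] has its root outside [K], so at an odd prime conjugation inverts this root
   instead of fixing it. *)
have odd_part p : p \in primes t -> p != 2%N -> (t`_p %| s.+1)%N.
  move=> pt p2; have pn := primes_t_fun pt.
  have := part_t_fun pn; rewrite t_primepowE (negPf p2) /=; set u := val _.
  case: ifP => [_ t1|/negbT Ku ->].
    by move: pt; rewrite -p_part_gt1 t1.
  have [p_pr _] := andP (etrans (esym (mem_primes p n)) pn).
  have f_dvd := pfactor_dvdnn p n.
  have pu : (p ^ logn p n).-primitive_root u by apply: (prim_zeta pz).
  have un : u ^+ n = 1 by apply/eqP; rewrite -(prim_order_dvd pu).
  have /orP[us|//] := odd_prime_dvdn_pred_succ p_pr p2 s0 (dvdn_trans f_dvd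
    n_dvd).
  case/negP: Ku; rewrite (conjugation_fixed conj_s un).
  move: us; rewrite (prim_order_dvd pu) => /eqP us.
  by rewrite -(prednK s0) exprS us mulr1.
case: ifP => [|/negbFE]; rewrite order_over_eq2 -/w; last first.
  move=> /andP[Kw Kw2]; have n2 := notin_base_primes pz (isT : prime 2) Kw.
  have t2 : (t`_2 = 2)%N
    by rewrite part_t_fun // t_primepowE -/w (negPf Kw) Kw2.
  have ys : y ^+ s.+1 = 1.
    apply/eqP; rewrite -(prim_order_dvd py); apply/dvdn_partP => [|p pt];
      first exact: t_fun_gt0.
    have [->|] := eqVneq p 2%N; last exact: odd_part.
    (* [s.-1] and [s.+1] have the same parity and an even product, so [s.+1] is even. *)
    have : (2 %| s.-1 * s.+1)%N by apply: dvdn_trans n_dvd; move: n2;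
      rewrite mem_primes => /and3P[].
    by rewrite t2 Euclid_dvdM // !dvdn2; case: (s) s0 => //= k _;
      rewrite negbK orbb.
  (* [w ^+ 2] is fixed and [w] is not. As conjugation also inverts [y], both factors of
     [w * (y - y^-1)] change sign. *)
  have ws : w ^+ s = - w.
    have : w ^+ s ^+ 2 == w ^+ 2.
      by rewrite -exprM mulnC exprM -(conjugation_fixed conj_s) // -exprM
        mulnC exprM wn expr1n.
    rewrite eqf_sqr => /pred2P[ws|//]; case/negP: Kw.
    by rewrite (conjugation_fixed conj_s wn) ws.
  have -> : w * (y - y^-1) = w * y + (-1) * (w * y^-1) by ring.
  have ys' : y ^+ s = y^-1 by apply: (mulfI y0); rewrite -exprS ys mulfV.
  have [_ _ ->] := conj_s;
    rewrite ?rpredN ?rpred1 ?exprMn ?wn ?yn ?exprVn ?yn ?invr1 ?mulr1 //.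
  by rewrite ws ys' invrK; apply/eqP; ring.
move=> ntw.
have part2 : 2%N \in primes t -> w \notin K /\ (t`_2 = 2 ^ e)%N.
  move=> pt; have := part_t_fun (primes_t_fun pt); rewrite t_primepowE -/w.
  case: ifP ntw => /= [_ _ t1|Kw /negbTE ->]; last by [].
  by move: pt; rewrite -p_part_gt1 t1.
case: (boolP (~~ `[< is_c2 iota zeta e >])) => [nc2|]; last first.
  rewrite negbK => /asboolP[[_ _ /asboolPn Kw _ /asboolP KwV] _].
  rewrite -/w -[`[< _ >]]/(w \in K) in Kw;
    rewrite -/w -[`[< _ >]]/(w - w^-1 \in K) in KwV.
  have n2 := notin_base_primes pz (isT : prime 2) Kw.
  have ws := conjugation_sub_inv conj_s wn Kw KwV.
  have two0 : 2%:R != 0 :> L.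
    by apply: (prim_root_dvd_eq0 pz); move: n2; rewrite mem_primes => /and3P[].
  (* The odd parts of [t] divide [s.+1]; its 2-part divides [s.+1 * 2] because [w ^+ s.+1 = -1]. *)
  have : (y ^+ s.+1) ^+ 2 == 1.
    rewrite -exprM -(prim_order_dvd py); apply/dvdn_partP => [|p pt];
      first exact: t_fun_gt0.
    have [p2|p2] := eqVneq p 2%N; last by rewrite dvdn_mulr ?odd_part.
    rewrite p2 in pt *; have [_ ->] := part2 pt.
    by rewrite (prim_order_dvd pw) exprM ws sqrrN expr1n.
  rewrite sqrf_eq1 => /pred2P[ys|ys];
    last exact: conjugation_sub_inv_mem conj_s yn ys.
  (* The value 1 is excluded: the full [2 ^ e] divides [t], so [w ^+ s.+1] would be 1 instead of
     -1. *)
  have : (2 ^ e %| s.+1)%N.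
    apply: (@dvdn_trans t); last by rewrite (prim_order_dvd py) ys.
    have := part_t_fun n2; rewrite t_primepowE -/w (negPf Kw).
    by move: ntw; rewrite Kw => /negbTE -> <-; apply: dvdn_part.
  rewrite (prim_order_dvd pw) ws eq_sym -addr_eq0 -(natrD _ 1 1) => /eqP two.
  by rewrite two eqxx in two0.
(* In the remaining case conjugation must invert [y], which is checked on each prime-power part of
   [t]. *)
apply: (conjugation_add_inv_mem conj_s yn); apply/eqP.
rewrite -(prim_order_dvd py); apply/dvdn_partP => [|p pt];
  first exact: t_fun_gt0.
have [p2|p2] := eqVneq p 2%N; last exact: odd_part.
rewrite p2 in pt *; have [Kw ->] := part2 pt.
have /orP[|] := two_dvdn_pred_succ s0 (dvdn_trans e_dvd n_dvd).
  (* Here [w ^+ s] is [w] or [- w], so [w ^+ 2] is in [K] and [w] would have order 2 over F. *)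
  rewrite (prim_order_dvd pw) mulnC exprM sqrf_eq1 => ws1.
  move: ntw; rewrite Kw /= => /negP[].
  have : w ^+ s ^+ 2 = w ^+ 2.
    have -> : w ^+ s = w ^+ s.-1 * w by rewrite -exprSr prednK.
    by rewrite exprMn; case/pred2P: ws1 => ->; rewrite ?sqrrN expr1n mul1r.
  rewrite -exprM mulnC exprM => w2s; rewrite (conjugation_fixed conj_s) ?w2s //.
  by rewrite -exprM mulnC exprM wn expr1n.
(* Now [w ^+ s.+1] is 1 or -1, and -1 would make [e] equal to c_2. *)
rewrite (prim_order_dvd pw) mulnC exprM sqrf_eq1 -(prim_order_dvd pw) =>
  /orP[//|/eqP ws].
have e_gt0 : (0 < e)%N.
  rewrite lt0n; apply: contraNneq Kw => e0.
  by have := prim_expr_order pw; rewrite e0 expr1 => ->; rewrite rpred1.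
case/negP: nc2; apply/asboolP/c2_spec_is_c2; split.
- exact: e_gt0.
- by have := pchar_prim_root pw;
  rewrite -(eq_pnat _ (eq_negn (fmorph_pchar iota))).
- exact/asboolPn.
(* The value 2 would mean [2 ^ e = 2], so [w] would be 1 or -1, both in [K]. *)
- rewrite /Defs.t_fun primesX // primes_prime // big_seq1 pfactorK //
  t_primepowE -/w.
  move: ntw; rewrite (negPf Kw) /= => /negbTE -> e1; case/negP: Kw.
  have := prim_expr_order pw; rewrite e1 => /eqP; rewrite sqrf_eq1.
  by case/pred2P=> wE; rewrite wE ?rpredN rpred1.
- exact/asboolP/(conjugation_sub_inv_mem conj_s wn ws).
Qed.

End Kappa.

Local Open Scope classical_set_scope.

Theorem theorem1 (F : fieldType) (L : closedFieldType)
  (iota : {rmorphism F -> L}) (zeta : nat -> mu_infty L) :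
  is_algebraic_closure iota ->
  is_primitive_choice F zeta ->
  mu_degree2 iota =
    equalizer (kappa iota zeta) (zero_map iota) `\` mu_infty_base iota.
Proof.
move=> _ zeta_prim; apply/seteqP; split=> z.
  case/adjoin_degree2P=> Kz quad_z; split; last exact/asboolPn.
  exact: quadratic_kappa_eq0.
case=> kz /asboolPn Kz; apply/adjoin_degree2P; split=> //.
exact: (kappa_eq0_quadratic zeta_prim kz).
Qed.
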